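(* Let $P,T\ge1$ and $N\ge 1$ be integers, let $X_1,\dots,X_N\in\mathbb{R}^{P,T}$ and let $h>0$. Let $K:\mathbb{R}^{P,T}\to\mathbb{R}_+$ be a differentiable kernel with unit integral and spherically symmetric, and let $\kappa:\mathbb{R}_+\to\mathbb{R}$ be a (differentiable) function such that $K(X)=\frac12\kappa(\mathrm{tr}(X^\top X))$ for all $X\in\mathbb{R}^{P,T}$, with derivative satisfying $\kappa'(u)\le0$ for all $u\in\mathbb{R}_+$. Let $$\hat f(X;h)=\frac{1}{Nh^{P\cdot T}}\sum_{n=1}^NK\big(h^{-1}(X-X_n)\big),$$ and, for $Y\in\mathbb{R}^{P,T}$ such that the denominators below are nonzero, define the mean-shift $$M(Y)=\frac{\sum_{n=1}^N\kappa'\big(h^{-2}\mathrm{tr}((X_n-Y)^\top(X_n-Y))\big)(X_n-Y)}{\sum_{n=1}^N\kappa'\big(h^{-2}\mathrm{tr}((X_n-Y)^\top(X_n-Y))\big)}$$ and the weights $$w_{n,h}(Y)=\frac{\kappa'\big(h^{-2}\mathrm{tr}((X_n-Y)^\top(X_n-Y))\big)}{\sum_{m=1}^N\kappa'\big(h^{-2}\mathrm{tr}((X_m-Y)^\top(X_m-Y))\big)},\qquad n=1,\dots,N.$$ Then, starting at any $Y^{(0)}\in\mathbb{R}^{P,T}$, the sequence defined (as long as the denominators are nonzero) by $$Y^{(s+1)}=Y^{(s)}+M(Y^{(s)})=\sum_{n=1}^Nw_{n,h}(Y^{(s)})\,X_n$$ (the two expressions being equal) describes a gradient ascent algorithm on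 $\hat f(\cdot;h)$: for every $s\ge 0$ there is a step size $\alpha_s>0$ such that $$Y^{(s+1)}=Y^{(s)}+\alpha_s\,\nabla\hat f(Y^{(s)};h).$$
   Context: $\mathbb{R}^{P,T}$ is the vector space of real $P\times T$ matrices and $\mathbb{R}_+=[0,\infty)$; at $0$, $\kappa'$ is the one-sided derivative. Integrals over $\mathbb{R}^{P,T}$ are component-wise (Lebesgue measure on $\mathbb{R}^{P\cdot T}$), and the gradient $\nabla\hat f(X;h)$ is the $P\times T$ matrix of partial derivatives $\partial\hat f/\partial x_{p,t}$. Spherically symmetric means that $K(X)$ depends on $X$ only through its Frobenius norm $\|X\|_F=\sqrt{\mathrm{tr}(X^\top X)}$. A gradient ascent algorithm on a function $g$ is an iteration of the form $Y^{(s+1)}=Y^{(s)}+\alpha_s\nabla g(Y^{(s)})$, with a positive step size $\alpha_s$ that is allowed to depend on $s$ (adaptive step size). *)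

(* Defs.v *)
From HB Require Import structures.
From mathcomp Require Import all_boot all_order all_algebra.
From mathcomp Require Import all_classical all_reals all_analysis.

Set Implicit Arguments.
Unset Strict Implicit.
Unset Printing Implicit Defensive.

Import Order.TTheory GRing.Theory Num.Theory.
Import numFieldNormedType.Exports.

Local Open Scope classical_set_scope.
Local Open Scope ring_scope.

Section lebesgue_tuple.
Variable R : realType.
Local Notation mR := (measurableTypeR R).

Definition cons_pair n (z : n.-tuple mR * mR) : n.+1.-tuple mR :=
  [the n.+1.-tuple mR of z.2 :: z.1].

Lemma measurable_cons_pair n : measurable_fun setT (@cons_pair n).
Proof. exact: measurable_cons. Qed.

Definition measure_cons n (m : {measure set (n.-tuple mR) -> \bar R}) :
  {measure set (n.+1.-tuple mR) -> \bar R}.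
Proof.
refine (pushforward (m \x (@lebesgue_measure R))%E (@cons_pair n)).
exact: measurable_cons_pair.
Defined.

(* Lebesgue measure on R^n, as an n-fold product; lebesgue_tuple_box gives its
   value on boxes. *)
Fixpoint lebesgue_tuple n : {measure set (n.-tuple mR) -> \bar R} :=
  match n with
  | 0 => dirac ([tuple] : 0.-tuple mR)
  | m.+1 => measure_cons (lebesgue_tuple m)
  end.

Lemma lebesgue_tuple_box n (A : 'I_n -> set mR) :
  (forall i, measurable (A i)) ->
  (lebesgue_tuple n [set x | forall i, A i (tnth x i)] =
   \prod_(i < n) lebesgue_measure (A i))%E.
Proof.
elim: n A => [|n IH] A mA.
  rewrite big_ord0 /= diracE.
  by rewrite mem_set//= => -[].
rewrite big_ord_recl /= /pushforward.
rewrite (_ : _ @^-1` _ =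
  [set x | forall i, A (lift ord0 i) (tnth x i)] `*` A ord0); last first.
  apply/seteqP; split=> -[t y] /=.
    move=> H; split; last by have := H ord0; rewrite tnth0.
    by move=> i; have := H (lift ord0 i); rewrite tnthS.
  move=> [Ht Hy] i; case: (unliftP ord0 i) => [j ->|->].
    by rewrite tnthS.
  by rewrite tnth0.
rewrite product_measure1E//; last first.
  rewrite (_ : [set _ | _] =
    \bigcap_(i in [set: 'I_n])
       ((fun x : n.-tuple mR => tnth x i) @^-1` A (lift ord0 i))); last first.
    by apply/seteqP; split=> x /= H i => [_|]; [exact: H | exact: (H i I)].
  apply: fin_bigcap_measurable => //= i _.
  by rewrite -[X in measurable X]setTI; exact: measurable_tnth.
by rewrite (IH (fun i => A (lift ord0 i)))// muleC.
Qed.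

End lebesgue_tuple.

Section mean_shift.
Variables (R : realType) (P T : nat).
Implicit Types (K g : 'M[R]_(P, T) -> R) (kappa : R -> R) (h : R).

Definition frobenius_norm (X : 'M[R]_(P, T)) : R := Num.sqrt (\tr (X^T *m X)).

Definition mx_of_tuple (x : (P * T).-tuple R) : 'M[R]_(P, T) :=
  vec_mx (\row_i tnth x i).

Definition unit_integral K : Prop :=
  (\int[@lebesgue_tuple R (P * T)]_x (K (mx_of_tuple x))%:E = 1)%E.

Definition spherically_symmetric K : Prop :=
  forall X Y, frobenius_norm X = frobenius_norm Y -> K X = K Y.

(* A function on [0, +oo[ is a total kappa : R -> R of which only the values at
   nonnegative reals matter; its derivative at 0 is the right derivative. *)
Definition derivable_nneg kappa : Prop :=
  cvg ((fun e => e^-1 * (kappa e - kappa 0)) @ 0^'+) /\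
  forall u, 0 < u -> derivable kappa u 1.

Definition derive_nneg kappa (u : R) : R :=
  if u == 0 then lim ((fun e => e^-1 * (kappa e - kappa 0)) @ 0^'+)
  else derive1 kappa u.

Definition gradient g (Y : 'M[R]_(P, T)) : 'M[R]_(P, T) :=
  \matrix_(p, t) 'D_(delta_mx p t) g Y.

(* The first conjunct says that the partial derivatives exist, 'D being a total
   operator. *)
Definition gradient_ascent_step g (alpha : R) (Y Y' : 'M[R]_(P, T)) : Prop :=
  (forall p t, derivable g Y (delta_mx p t)) /\
  Y' = Y + alpha *: gradient g Y.

Variables (N : nat) (X : 'I_N -> 'M[R]_(P, T)).

Definition kernel_density K h (Y : 'M[R]_(P, T)) : R :=
  (N%:R * h ^+ (P * T))^-1 * \sum_(n < N) K (h^-1 *: (Y - X n)).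

Definition kappa_coef kappa h (Y : 'M[R]_(P, T)) (n : 'I_N) : R :=
  derive_nneg kappa (h ^- 2 * \tr ((X n - Y)^T *m (X n - Y))).

Definition kappa_denom kappa h (Y : 'M[R]_(P, T)) : R :=
  \sum_(n < N) kappa_coef kappa h Y n.

Definition mean_shift kappa h (Y : 'M[R]_(P, T)) : 'M[R]_(P, T) :=
  (kappa_denom kappa h Y)^-1 *: \sum_(n < N) kappa_coef kappa h Y n *: (X n - Y).

Definition mean_shift_weight kappa h (Y : 'M[R]_(P, T)) (n : 'I_N) : R :=
  kappa_coef kappa h Y n / kappa_denom kappa h Y.

(* Meaningful up to the first index at which kappa_denom vanishes. *)
Definition mean_shift_seq kappa h (Y0 : 'M[R]_(P, T)) (s : nat) : 'M[R]_(P, T) :=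
  iter s (fun Y => Y + mean_shift kappa h Y) Y0.

End mean_shift.

(* Main.v *)
(* The chain rule gives grad K (Z) = kappa'(tr (Z^T Z)) Z, so with
   D = \sum_n kappa'(h^-2 tr ((X_n - Y)^T (X_n - Y))) the gradient of the
   density at Y is - D / (N h^(PT) h^2) times the mean shift M(Y).  As kappa' <= 0
   and D != 0, we have D < 0, and alpha = - N h^(PT) h^2 / D is positive. *)

Require Import Defs.
From HB Require Import structures.
From mathcomp Require Import all_boot all_order all_algebra.
From mathcomp Require Import all_classical all_reals all_analysis.
From mathcomp Require Import ring.

Import Order.TTheory GRing.Theory Num.Theory.
Import numFieldNormedType.Exports.

Local Open Scope classical_set_scope.
Local Open Scope ring_scope.

Section trace_square.
Variables (R : realType) (P T : nat).
Implicit Types Z V : 'M[R]_(P, T).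

Lemma mxtrace_mul_trE Z V : \tr (Z^T *m V) = \sum_t \sum_p Z p t * V p t.
Proof.
by apply: eq_bigr => t _; rewrite mxE; apply: eq_bigr => p _; rewrite mxE.
Qed.

Lemma mxtrace_mul_trC Z V : \tr (Z^T *m V) = \tr (V^T *m Z).
Proof. by rewrite -mxtrace_tr trmx_mul trmxK. Qed.

Lemma mxtrace_mul_trN Z : \tr ((- Z)^T *m (- Z)) = \tr (Z^T *m Z).
Proof. by rewrite [(- Z)^T]linearN/= mulNmx mulmxN opprK. Qed.

Lemma mxtrace_mul_trZ (k : R) Z :
  \tr ((k *: Z)^T *m (k *: Z)) = k ^+ 2 * \tr (Z^T *m Z).
Proof.
by rewrite [(k *: Z)^T]linearZ/= -scalemxAl -scalemxAr scalerA mxtraceZ expr2.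
Qed.

Lemma mxtrace_mul_tr_ge0 Z : 0 <= \tr (Z^T *m Z).
Proof.
rewrite mxtrace_mul_trE; apply: sumr_ge0 => t _; apply: sumr_ge0 => p _.
by rewrite -expr2 sqr_ge0.
Qed.

Lemma mxtrace_mul_tr_eq0 Z : \tr (Z^T *m Z) = 0 -> Z = 0.
Proof.
rewrite mxtrace_mul_trE => /eqP; rewrite psumr_eq0 => [/allP Z0|t _]; last first.
  by apply: sumr_ge0 => p _; rewrite -expr2 sqr_ge0.
apply/matrixP => p t; rewrite mxE.
have /= := Z0 t (mem_index_enum t); rewrite psumr_eq0 => [/allP|q _]; last first.
  by rewrite -expr2 sqr_ge0.
by move/(_ p (mem_index_enum p)); rewrite /= -expr2 sqrf_eq0 => /eqP.
Qed.

(** Used to read off the entries of a gradient from a formula for directional derivatives. *)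
Lemma mxtrace_mul_tr_delta Z p t : \tr (Z^T *m delta_mx p t) = Z p t.
Proof.
rewrite mxtrace_mul_trE (bigD1 t)//= (bigD1 p)//= !mxE !eqxx mulr1.
rewrite big1 ?addr0 => [|q /negPf qp]; last by rewrite mxE qp mulr0.
rewrite big1 ?addr0// => u /negPf ut.
by apply: big1 => q _; rewrite mxE ut andbF mulr0.
Qed.

(** Along a line the squared norm is a quadratic polynomial in [e], whose linear coefficient carries
    the directional derivative. *)
Lemma mxtrace_mul_tr_line Z V (e : R) :
  \tr ((e *: V + Z)^T *m (e *: V + Z)) =
  \tr (Z^T *m Z) + 2 * \tr (Z^T *m V) * e + \tr (V^T *m V) * e ^+ 2.
Proof.
rewrite [(_ + _)^T]linearP/= mulmxDl !mulmxDr.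
rewrite -!scalemxAl -!scalemxAr !mxtraceD !mxtraceZ (mxtrace_mul_trC V Z).
by ring.
Qed.

End trace_square.

Section directional_derivative.
Variables (R : realType) (V : normedModType R).

(** Both sides are limits of the same difference quotient. This makes the one-variable chain rule
    applicable to directional derivatives. *)
Lemma derive_line (f : V -> R) x v :
  'D_v f x = (fun e : R => f (e *: v + x))^`()%classic 0.
Proof.
rewrite derive1E /derive.
congr (lim (_ @ 0^')); apply/funext => e /=.
by rewrite addr0 scale0r add0r [_%:A]mulr1.
Qed.

(** Evenness gives equal derivatives along [v] and [- v], whereas linearity of the differential
    makes them opposite; twice the derivative is thus 0. *)
Lemma derive_even (f : V -> R) v :
  differentiable f 0 -> (forall x, f (- x) = f x) -> 'D_v f 0 = 0.
Proof.
move=> df f_even.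
have : 'D_(- v) f 0 = 'D_v f 0.
  rewrite /derive; congr (lim (_ @ 0^')); apply/funext => e /=.
  by rewrite !addr0 scalerN f_even.
rewrite !deriveE// linearN => /eqP; rewrite -subr_eq0 -opprD oppr_eq0.
by rewrite -mulr2n mulrn_eq0 => /eqP.
Qed.

Lemma derive_comp_affine (f : V -> R) (k : R) (c x v : V) :
  differentiable f (k *: (x - c)) ->
  is_derive x v (fun y => f (k *: (y - c))) (k * 'D_v f (k *: (x - c))).
Proof.
move=> df.
(* The differential of an affine map is its linear part. *)
have dg : is_diff x (fun y : V => k *: (y - c)) (fun y => k *: y).
  have -> : (fun y : V => k *: (y - c)) = k \*: (id - cst c) by [].
  by apply: is_diff_eq; apply/funext => y /=; rewrite !fctE subr0.
have dgx := @ex_diff _ _ _ _ _ _ _ dg.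
have dfg := differentiable_comp dgx df.
apply: DeriveDef; first exact: diff_derivable dfg.
by rewrite !deriveE// diff_comp//= diff_val linearZ.
Qed.

End directional_derivative.

Section radial_kernel.
Variables (R : realType) (P T : nat).
Variables (K : 'M[R]_(P, T) -> R) (kappa : R -> R).
Hypothesis K_diff : forall Y, differentiable K Y.
Hypothesis kappa_diff : derivable_nneg kappa.
Hypothesis K_kappa : forall Y, K Y = 2^-1 * kappa (\tr (Y^T *m Y)).

Lemma derive_radial_kernel Z V :
  'D_V K Z = derive_nneg kappa (\tr (Z^T *m Z)) * \tr (Z^T *m V).
Proof.
have [Z0|Z_neq0] := eqVneq (\tr (Z^T *m Z)) 0.
  (* kappa has only a right derivative at 0, so the chain rule is not available
     at Z = 0; instead K is even, hence its derivative at 0 vanishes. *)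
  rewrite (mxtrace_mul_tr_eq0 _ _ _ _ Z0) trmx0 !mul0mx mxtrace0 mulr0.
  apply: derive_even => // Y; by rewrite !K_kappa mxtrace_mul_trN.
have Z_gt0 : 0 < \tr (Z^T *m Z) by rewrite lt_def Z_neq0 mxtrace_mul_tr_ge0.
rewrite /derive_nneg (negbTE Z_neq0).
(* [p] is the squared norm along the line through [Z] in direction [V]. Its value at 0 is positive,
   so [kappa] has a two-sided derivative there. *)
pose p : {poly R} := (\tr (Z^T *m Z))%:P + (2 * \tr (Z^T *m V)) *: 'X
  + (\tr (V^T *m V)) *: 'X^2.
have p0 : p.[0] = \tr (Z^T *m Z) by rewrite /p !hornerE/=; ring.
have dp : (horner p)^`()%classic 0 = 2 * \tr (Z^T *m V).
  by rewrite -derivE /p !poly.derivE !hornerE/=; ring.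
have -> : 'D_V K Z = (2^-1 *: (kappa \o horner p))^`()%classic 0.
  rewrite derive_line; congr (derive1 _ 0); apply/funext => e /=.
  by rewrite K_kappa mxtrace_mul_tr_line !fctE /p !hornerE.
have kp : derivable kappa p.[0] 1 by rewrite p0; apply: kappa_diff.2.
have dph : derivable (horner p) 0 1 by exact: derivable_horner.
rewrite derive1E deriveZ/=; last first.
  by apply/derivable1_diffP/differentiable_comp; apply/derivable1_diffP.
(* The 2 in the derivative of [p] cancels the factor 1/2 in [K_kappa]. *)
rewrite -derive1E derive1_comp// p0 dp mulrCA.
by rewrite -[_ *: _]/(_ * _) mulKf ?pnatr_eq0.
Qed.

Variables (N : nat) (X : 'I_N -> 'M[R]_(P, T)) (h : R).

Lemma is_derive_kernel_density Y V :
  is_derive Y V (kernel_density X K h)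
    ((N%:R * h ^+ (P * T))^-1 * \sum_(n < N)
       h^-1 * 'D_V K (h^-1 *: (Y - X n))).
Proof.
pose f n (Y : 'M[R]_(P, T)) := K (h^-1 *: (Y - X n)).
have -> : kernel_density X K h =
    (N%:R * h ^+ (P * T))^-1 \*: \sum_(n < N) f n.
  by apply/funext => Z; rewrite /kernel_density /= fct_sumE.
by apply: is_deriveZ; apply: is_derive_sum => n; exact: derive_comp_affine.
Qed.

(** Of the two factors [h^-1] merged into [h ^+ 2], one comes from the inner derivative and one from
    the point [h^-1 *: (Y - X n)] itself. The sign comes from turning [Y - X n] into [X n - Y]. *)
Lemma gradient_kernel_density Y :
  gradient (kernel_density X K h) Y =
  - (N%:R * h ^+ (P * T) * h ^+ 2)^-1 *:
    \sum_(n < N) kappa_coef X kappa h Y n *: (X n - Y).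
Proof.
apply/matrixP => p t; rewrite !mxE.
have [_ ->] := is_derive_kernel_density Y (delta_mx p t).
rewrite summxE !mulr_sumr; apply: eq_bigr => n _.
rewrite derive_radial_kernel mxtrace_mul_tr_delta mxtrace_mul_trZ exprVn.
rewrite -(opprB (X n)) mxtrace_mul_trN /kappa_coef !mxE expr2 !invfM.
by ring.
Qed.

End radial_kernel.

(** The weights sum to 1, so the [Y] subtracted inside the mean shift cancels the [Y] added
    outside. *)
Lemma mean_shift_weightE (R : realType) (P T N : nat)
    (X : 'I_N -> 'M[R]_(P, T)) (kappa : R -> R) (h : R) Y :
  kappa_denom X kappa h Y != 0 ->
  Y + mean_shift X kappa h Y =
  \sum_(n < N) mean_shift_weight X kappa h Y n *: X n.
Proof.
move=> d_neq0; rewrite /mean_shift.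
under eq_bigr do rewrite scalerBr.
rewrite sumrB -scaler_suml scalerBr scalerA mulVf// scale1r addrC subrK.
by rewrite scaler_sumr; apply: eq_bigr => n _; rewrite scalerA mulrC.
Qed.

Theorem proposition2 (R : realType) (P T N : nat)
    (P_gt0 : (0 < P)%N) (T_gt0 : (0 < T)%N) (N_gt0 : (0 < N)%N)
    (X : 'I_N -> 'M[R]_(P, T)) (h : R) (h_gt0 : 0 < h)
    (K : 'M[R]_(P, T) -> R)
    (K_ge0 : forall Y, 0 <= K Y)
    (K_diff : forall Y, differentiable K Y)
    (K_int : unit_integral K)
    (K_sph : spherically_symmetric K)
    (kappa : R -> R)
    (kappa_diff : derivable_nneg kappa)
    (K_kappa : forall Y, K Y = 2^-1 * kappa (\tr (Y^T *m Y)))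
    (kappa_decr : forall u, 0 <= u -> derive_nneg kappa u <= 0) :
  (forall Y, kappa_denom X kappa h Y != 0 ->
     Y + mean_shift X kappa h Y =
     \sum_(n < N) mean_shift_weight X kappa h Y n *: X n) /\
  (forall (Y0 : 'M[R]_(P, T)) (s : nat),
     (forall r, (r <= s)%N ->
        kappa_denom X kappa h (mean_shift_seq X kappa h Y0 r) != 0) ->
     exists alpha : R, 0 < alpha /\
       gradient_ascent_step (kernel_density X K h) alpha
         (mean_shift_seq X kappa h Y0 s) (mean_shift_seq X kappa h Y0 s.+1)).
Proof.
split=> [Y|Y0 s d_neq0]; first exact: mean_shift_weightE.
have := d_neq0 s (leqnn s); rewrite /mean_shift_seq /=.
set Y := iter s _ Y0 => dY_neq0.
have dY_lt0 : kappa_denom X kappa h Y < 0.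
  rewrite lt_def eq_sym dY_neq0; apply: sumr_le0 => n _; apply: kappa_decr.
  by rewrite mulr_ge0 ?mxtrace_mul_tr_ge0// invr_ge0 exprn_ge0// ltW.
have c_gt0 : 0 < N%:R * h ^+ (P * T) * h ^+ 2.
  by rewrite !mulr_gt0 ?ltr0n ?exprn_gt0.
exists (- (N%:R * h ^+ (P * T) * h ^+ 2 / kappa_denom X kappa h Y)); split.
  by rewrite oppr_gt0 pmulr_rlt0 ?invr_lt0.
split=> [p t|].
  by have [] := is_derive_kernel_density _ _ _ K K_diff _ X h Y (delta_mx p t).
(* The two minus signs cancel, and so does the constant of [c_gt0], leaving the factor
   [(kappa_denom X kappa h Y)^-1] of the mean shift. *)
rewrite (gradient_kernel_density _ _ _ _ kappa)// scalerA mulrNN.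
by rewrite mulrAC mulfV ?gt_eqF// mul1r.
Qed.
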